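(* $\text{\ss}_o \leq \mathbf{non}(\mathcal{M})$, where $\text{\ss}_o$ is the subseries number for divergence by oscillation and $\mathbf{non}(\mathcal{M})$ is the uniformity of Baire category.
   Context: $\mathbb{N}=\{1,2,3,\dots\}$. For $A\subseteq\mathbb{N}$, the subseries $\sum_{n\in A}a_n$ is summed in increasing order of the indices. A series is conditionally convergent if it converges but not absolutely. A series diverges by oscillation if its partial sums neither converge to a real number nor tend to $+\infty$ nor tend to $-\infty$. $\text{\ss}_o$ is the smallest cardinality of a family $\mathcal{A}$ of subsets of $\mathbb{N}$ such that for every conditionally convergent series $\sum_{n\in\mathbb{N}}a_n$ of real numbers there is $A\in\mathcal{A}$ such that $\sum_{n\in A}a_n$ diverges by oscillation. $\mathbf{non}(\mathcal{M})$ is the minimum cardinality of a non-meager subset of the Cantor space $2^{\mathbb{N}}$. *)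

(* Defs.v *)
From HB Require Import structures.
From mathcomp Require Import all_boot all_order all_algebra.
From mathcomp Require Import all_classical all_reals all_analysis.

Set Implicit Arguments.
Unset Strict Implicit.
Unset Printing Implicit Defensive.

Import Order.TTheory GRing.Theory Num.Theory.
Import numFieldNormedType.Exports.

Local Open Scope classical_set_scope.
Local Open Scope card_scope.
Local Open Scope ring_scope.

(* Series are indexed by nat, i.e. from 0 instead of 1; the two index sets are
   order-isomorphic. *)

Definition conditionally_convergent (R : realType) (a : R ^nat) : Prop :=
  cvgn (series a) /\ ~ cvgn [series `|a n|]_n.

(* The partial sums of the subseries over A are taken over A `&` {0, ..., n-1}:
   this is the sequence of partial sums along the increasing enumeration of A,
   with terms repeated at the indices outside A (and eventually constant when A
   is finite), so both have the same limit behaviour. *)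
Definition subseries (R : realType) (a : R ^nat) (A : set nat) : R ^nat :=
  fun n => \sum_(0 <= k < n | k \in A) a k.

Definition oscillates (R : realType) (u : R ^nat) : Prop :=
  [/\ ~ cvgn u, ~ (u @ \oo --> +oo) & ~ (u @ \oo --> -oo)].

Definition oscillation_family (R : realType) (F : set (set nat)) : Prop :=
  forall a : R ^nat, conditionally_convergent a ->
    exists2 A, F A & oscillates (subseries a A).

Definition nowhere_dense (T : topologicalType) (A : set T) : Prop :=
  (closure A)° = set0.

Definition meager (T : topologicalType) (A : set T) : Prop :=
  exists2 F : (set T)^nat,
    forall n, nowhere_dense (F n) & A `<=` \bigcup_n F n.

(* Cardinals are represented by sets up to equipotence: A represents the
   smallest cardinality of a set satisfying P. *)
Definition least_cardinality (T : Type) (P : set T -> Prop) (A : set T) : Prop :=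
  P A /\ forall B, P B -> A #<= B.

Definition is_subseries_number_osc (R : realType) (S : set (set nat)) : Prop :=
  least_cardinality (oscillation_family R) S.

Definition is_non_meager_number (N : set cantor_space) : Prop :=
  least_cardinality (fun B : set cantor_space => ~ meager B) N.

(* Main.v *)
(* For a conditionally convergent series, the positive terms alone have sum +oo
   and the negative ones -oo. Hence any finite initial segment of a set A of
   indices can be extended so as to make the partial sums of the subseries over
   A exceed a given bound, in either direction: the sets A whose subseries has
   partial sums unbounded in both directions are comeager. A non-meager set of
   subsets of nat therefore contains, for every conditionally convergent series,
   a set whose subseries oscillates. *)
Require Import Defs.
From mathcomp Require Import all_boot all_order all_algebra.
From mathcomp Require Import all_classical all_reals all_analysis.
From mathcomp Require Import ring lra.

Set Implicit Arguments.
Unset Strict Implicit.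
Unset Printing Implicit Defensive.

Import Order.TTheory GRing.Theory Num.Theory.
Import numFieldNormedType.Exports.

Local Open Scope classical_set_scope.

(* Consider families of maps choosing a point in each set satisfying [P] such
   that distinct members of the family differ at every set. A maximal family
   exhausts some set [A]: otherwise one more choice map avoiding all the used
   points could be added. Evaluation at [A] and at any other [B] then gives an
   injection of [A] into [B]. *)
Lemma least_cardinality_exists (T : Type) (P : set T -> Prop) :
  (exists A, P A) -> exists A, least_cardinality P A.
Proof.
move=> [A0 PA0]; pose I := {A : set T | P A}.
pose Q (M : set (I -> T)) := (forall f, M f -> forall i, sval i (f i)) /\
  (forall f g, M f -> M g -> forall i, f i = g i -> f = g).
have [F FQ Ftot|M [[MI Minj] Mmax]] := @Zorn_bigcup _ Q.
  split=> [f [X FX Xf]|f g [X FX Xf] [Y FY Yg] i fgi].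
    exact: (FQ _ FX).1.
  have [XY|YX] := Ftot _ _ FX FY.
    by apply: (FQ _ FY).2 fgi => //; exact: XY.
  by apply: (FQ _ FX).2 fgi => //; exact: YX.
have [i0 Mi0] : exists i0 : I, sval i0 `<=` (fun f => f i0) @` M.
  apply: contrapT => /forallNP noi.
  have /choice[f ffresh] : forall i : I, exists t, sval i t /\
      ~ ((fun f => f i) @` M) t.
    move=> i; apply: contrapT => nt; apply: (noi i) => t it.
    by apply: contrapT => Mt; apply: nt; exists t.
  apply: (Mmax (M `|` [set f])).
    split=> [|/(_ f (or_intror erefl)) Mf]; first exact: subsetUl.
    by apply: (ffresh (exist _ A0 PA0)).2; exists f.
  split=> [g [/MI//|->] i|g h [Mg|->] [Mh|->] i ghi //].
  - exact: (ffresh i).1.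
  - exact: Minj ghi.
  - by case: (ffresh i).2; exists g.
  - by case: (ffresh i).2; exists h.
exists (sval i0); split=> [|B PB]; first exact: svalP.
apply: card_le_trans (subset_card_le Mi0) _.
apply: card_le_trans (card_image_le _ _) _.
have /injfunPex[f] : exists2 f : (I -> T) -> T, set_fun M B f & set_inj M f.
  exists (fun f => f (exist _ B PB)) => [f /MI/(_ (exist _ B PB))//|f g].
  by move=> /set_mem Mf /set_mem Mg; exact: Minj.
exact: inj_card_le f.
Qed.

Definition cylinder (x : cantor_space) (n : nat) : set cantor_space :=
  [set y | forall i, (i < n)%N -> x i = y i].

Lemma cylinder_nbhs (x : cantor_space) (n : nat) : nbhs x (cylinder x n).
Proof.
elim: n => [|n IH].
  by apply: filterS (filterT : nbhs x setT) => y _ i; rewrite ltn0.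
have xn : nbhs x (proj n @^-1` [set x n]).
  apply: (@proj_continuous nat (fun=> bool : topologicalType) n x).
  exact: (@discrete_set1 bool).
apply: filterS (filterI IH xn) => y [yx yn] i.
by rewrite ltnS leq_eqVlt => /predU1P[->|/yx//]; rewrite -yn.
Qed.

Lemma nbhs_cylinder (x : cantor_space) (U : set cantor_space) :
  nbhs x U -> exists n, cylinder x n `<=` U.
Proof.
pose G := filter_from [set: nat] (cylinder x).
have GF : Filter G.
  apply: filter_from_filter; first by exists 0%N.
  move=> i j _ _; exists (maxn i j) => // y xy.
  by split=> k kn; apply: xy; rewrite leq_max kn ?orbT.
suff /[apply] : G --> x by move=> [n _ nU]; exists n.
(* The product topology is the supremum of the topologies induced by the coordinates, so convergence
   is checked at one coordinate [i], which a cylinder of length [i.+1] already fixes. *)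
apply/cvg_sup => i V [W [[A oA AW] Wx] WV]; exists i.+1 => // y xy.
apply: WV; move: Wx; rewrite -AW /=; congr (A _); exact: xy.
Qed.

Lemma nowhere_dense_cantorP (A : set cantor_space) : nowhere_dense A <->
  forall x n, exists y m, cylinder x n y /\ cylinder y m `&` A = set0.
Proof.
split=> [A0 x n|H].
  have /existsNP[y /not_implyP[xy]] : ~ (cylinder x n `<=` closure A).
    by move=> /filterS/(_ (cylinder_nbhs x n)) xA; have : set0 x by rewrite -A0.
  move=> /existsNP[U] /not_implyP[yU] /nonemptyPn UA; have [m mU] := nbhs_cylinder yU.
  exists y, m; split => //; apply/seteqP; split=> // z [/mU Uz Az].
  by rewrite -UA.
apply/seteqP; split => // x /nbhs_cylinder[n xn].
have [y [m [/xn yA ym]]] := H x n.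
have [z [Az yz]] := yA _ (cylinder_nbhs y m).
by have : set0 z by rewrite -ym; split.
Qed.

(** Baire's argument: each [F k] is avoided by shrinking to a subcylinder, and the nested cylinders
    share a point outside every [F k]. This makes the class of non-meager sets nonempty, so that a
    least cardinality exists. *)
Lemma cantor_space_non_meager : ~ meager [set: cantor_space].
Proof.
move=> [F ndF FT].
have /choice[next nextP] : forall s : nat * (cantor_space * nat),
    exists t : cantor_space * nat, [/\ cylinder s.2.1 s.2.2 t.1, (s.2.2 < t.2)%N &
        cylinder t.1 t.2 `&` F s.1 = set0].
  move=> [k [x n]]; have /nowhere_dense_cantorP/(_ x n)[y [m [xy ym]]] := ndF k.
  (* The [n.+1] makes the lengths grow strictly, so that the nested cylinders determine every
     coordinate of the limit point. *)
  exists (y, maxn m n.+1); split => //=; first by rewrite leq_max ltnSn orbT.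
  apply/seteqP; split => // z [yz Fz]; rewrite -ym; split=> // i im.
  by apply: yz; rewrite leq_max im.
pose fix s k := if k is j.+1 then next (j, s j) else (point, 0%N).
have sP k : [/\ cylinder (s k).1 (s k).2 (s k.+1).1, ((s k).2 < (s k.+1).2)%N &
    cylinder (s k.+1).1 (s k.+1).2 `&` F k = set0] := nextP (k, s k).
have s_ge k : (k <= (s k).2)%N.
  by elim: k => // k /leq_ltn_trans; apply; have [] := sP k.
have s_cyl k j : cylinder (s k).1 (s k).2 (s (k + j)%N).1 /\
    ((s k).2 <= (s (k + j)%N).2)%N.
  elim: j => [|j [IH1 IH2]]; first by rewrite addn0.
  rewrite addnS; have [c1 c2 _] := sP (k + j)%N.
  split; last exact: leq_trans (ltnW c2).
  by move=> i ik; rewrite (IH1 _ ik); apply: c1; exact: leq_trans IH2.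
(* Stage [i.+1] has length at least [i.+1], hence coordinate [i] no longer changes from there on. *)
pose y : cantor_space := fun i => (s i.+1).1 i.
have yP k : cylinder (s k).1 (s k).2 y.
  move=> i ik; rewrite /y; have [ki|ik'] := leqP k i.+1.
    by rewrite -(subnKC ki); apply: (s_cyl _ _).1.
  rewrite -(subnKC (ltnW ik')); symmetry; apply: (s_cyl _ _).1.
  by rewrite (leq_trans _ (s_ge _)).
have [k _ Fky] := FT y I.
by have [_ _ Fk] := sP k; have : set0 y by rewrite -Fk; split.
Qed.

Local Open Scope ring_scope.

Lemma conditionally_convergentN (R : realType) (a : R ^nat) :
  conditionally_convergent a -> conditionally_convergent (- a).
Proof.
move=> [ca nca]; split; first by rewrite seriesN; exact: is_cvgN.
by under [X in ~ cvgn (series X)]eq_fun do rewrite normrN.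
Qed.

(** The sums [p] of the positive terms are nondecreasing. If they converged, the identity |t| = 2
    max(t, 0) - t would make the series of absolute values converge too. *)
Lemma conditionally_convergent_pos (R : realType) (a : R ^nat) :
  conditionally_convergent a ->
  (fun n => \sum_(0 <= k < n | 0 < a k) a k) @ \oo --> +oo.
Proof.
move=> [ca nca]; apply: nondecreasing_dvgn_lt => [m n mn|cp].
  rewrite [leRHS](big_cat_nat _ mn)//= lerDl.
  by apply: sumr_ge0 => i /ltW.
pose p n := \sum_(0 <= k < n | 0 < a k) a k.
apply: nca; suff -> : [series `|a n|]_n = p + p - series a.
  exact: is_cvgB (is_cvgD cp cp) ca.
apply/funext => n; rewrite !fctE /p /series /=.
rewrite (big_mkcond (fun k => 0 < a k)) -big_split -sumrB /=.
apply: eq_bigr => k _.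
by case: ifPn => [/gtr0_norm|]; [|rewrite -leNgt => /ler0_norm] => ->; ring.
Qed.

Lemma subseriesN (R : realType) (a : R ^nat) (A : set nat) (n : nat) :
  subseries (- a) A n = - subseries a A n.
Proof. by rewrite /subseries -sumrN. Qed.

Lemma nowhere_dense_bounded_subseries (R : realType) (a : R ^nat) (M : R) :
  conditionally_convergent a ->
  nowhere_dense [set x : cantor_space |
    forall n, subseries a [set k | x k] n <= M].
Proof.
move=> /conditionally_convergent_pos a_pos.
apply/nowhere_dense_cantorP => x m.
(* Beyond the prescribed segment, [y] selects exactly the positive terms. *)
pose y : cantor_space := fun k => if (k < m)%N then x k else 0 < a k.
pose p n := \sum_(0 <= k < n | 0 < a k) a k.
pose q n := \sum_(0 <= k < n | y k) a k.
(* The gain [p n - p m] made between [m] and [n] must exceed [M - q m], which gives [q n > M]. *)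
have [n mn nM] : exists2 n, (m <= n)%N & M - q m + p m < p n.
  suff : \forall n \near \oo, (m <= n)%N /\ M - q m + p m < p n.
    by case/filter_ex => n [? ?]; exists n.
  apply: filterI; first exact: nbhs_infty_ge.
  by move/cvgryPgt : a_pos; exact.
exists y, n; split=> [i im|]; first by rewrite /y im.
apply/seteqP; split => // z [yz /(_ n)]; rewrite leNgt => /negP; apply.
have -> : subseries a [set k | z k] n = q n.
  rewrite /subseries /q big_nat_cond [RHS]big_nat_cond; apply: eq_bigl => i.
  rewrite mem_setE /=.
  by case: ltnP => //= ni; rewrite (yz _ ni).
have cat (P : pred nat) : \sum_(0 <= k < n | P k) a k =
    \sum_(0 <= k < m | P k) a k + \sum_(m <= k < n | P k) a k.
  exact: big_cat_nat.
move: nM; rewrite [p n]cat [q n]cat -/(p m) -/(q m).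
have -> : \sum_(m <= k < n | y k) a k = \sum_(m <= k < n | 0 < a k) a k.
  rewrite big_nat_cond [RHS]big_nat_cond; apply: eq_bigl => i.
  by case: (leqP m i) => //= mi; rewrite /y (ltnNge i m) mi.
lra.
Qed.

Lemma near_le_has_ubound (R : realType) (u : R ^nat) (M : R) :
  (\forall n \near \oo, u n <= M) -> exists B, forall n, u n <= B.
Proof.
move=> [N _ uM]; exists (Num.max M (\big[Num.max/M]_(i < N) u i)) => n.
rewrite le_max; have [nN|/uM->//] := ltnP n N.
by rewrite (le_bigmax _ (fun i : 'I_N => u i) (Ordinal nN)) orbT.
Qed.

(** Convergence and divergence to -oo each give an upper bound, divergence to +oo a lower bound. *)
Lemma not_oscillates_bounded (R : realType) (u : R ^nat) : ~ oscillates u ->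
  (exists B, forall n, u n <= B) \/ (exists B, forall n, - u n <= B).
Proof.
move=> /not_and3P[/contrapT cu|/contrapT cu|/contrapT cu].
- left; apply: (@near_le_has_ubound _ _ (limn u + 1)).
  by apply: (cvgr_le (limn u)) => //; rewrite ltrDl.
- right; apply: (@near_le_has_ubound _ (- u) 0).
  by move/cvgryPge : cu => /(_ 0); apply: filterS => n; rewrite oppr_le0.
- by left; apply: (@near_le_has_ubound _ _ 0); move/cvgrNyPle : cu; exact.
Qed.

Lemma meager_not_oscillates (R : realType) (a : R ^nat) :
  conditionally_convergent a ->
  meager [set x : cantor_space | ~ oscillates (subseries a [set k | x k])].
Proof.
(* Even indices [2j] carry the upper bound [j], odd indices [2j+1] the lower bound [-j], written as
   an upper bound for [- a]. *)
move=> ca; exists (fun n => [set x : cantor_space | forall k,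
    subseries (if odd n then - a else a) [set k | x k] k <= (n./2)%:R]).
  move=> n; apply: nowhere_dense_bounded_subseries.
  by case: ifP => // _; exact: conditionally_convergentN.
move=> x /not_oscillates_bounded[|] [B uB].
- exists (Num.bound `|B|).*2 => // k.
  rewrite odd_double doubleK (le_trans (uB k))// (le_trans (ler_norm _))//.
  exact/ltW/archi_boundP/normr_ge0.
- exists (Num.bound `|B|).*2.+1 => // k.
  rewrite /= odd_double /= uphalf_double subseriesN (le_trans (uB k))//.
  by rewrite (le_trans (ler_norm _))//; exact/ltW/archi_boundP/normr_ge0.
Qed.

Lemma non_meager_oscillation_family (R : realType) (N : set cantor_space) :
  ~ meager N ->
  oscillation_family R ((fun x : cantor_space => [set k | x k]) @` N).
Proof.
move=> nmN a /meager_not_oscillates[F ndF xF]; apply: contrapT => noA.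
apply: nmN; exists F => // x Nx; apply: xF => ox; apply: noA.
by exists [set k | x k] => //; exists x.
Qed.

Local Open Scope card_scope.

Theorem theorem13 (R : realType) :
  exists (S : set (set nat)) (N : set cantor_space),
    [/\ is_subseries_number_osc R S, is_non_meager_number N & S #<= N].
Proof.
have [|N [nmN minN]] :=
    @least_cardinality_exists cantor_space (fun B => ~ meager B).
  by exists setT; exact: cantor_space_non_meager.
(* This one family shows that oscillation families exist and also bounds their least cardinality by
   that of [N]. *)
have oscN := non_meager_oscillation_family (R := R) nmN.
have [|S [oscS minS]] := @least_cardinality_exists _ (oscillation_family R).
  by eexists; exact: oscN.
exists S, N; split=> //.
exact: card_le_trans (minS _ oscN) (card_image_le _ _).
Qed.
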